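(* A topological space $X$ is homeomorphic to a countably based MF space (i.e. to $\mathrm{MF}(P)$ for some countable poset $P$) if and only if $X$ is second countable, $T_1$, and has the strong Choquet property.
   Context: A poset is a set $P$ with a reflexive, antisymmetric, transitive relation $\preceq$. A filter on $P$ is a nonempty subset $F\subseteq P$ such that (1) for all $p,q\in F$ there is $r\in F$ with $r\preceq p$ and $r\preceq q$, and (2) if $p\in F$, $q\in P$ and $p\preceq q$ then $q\in F$. A filter is maximal if no strictly larger filter contains it. $\mathrm{MF}(P)$ is the set of maximal filters on $P$, with the topology having basis $\{N_p : p\in P\}$, where $N_p=\{F\in \mathrm{MF}(P) : p\in F\}$. The strong Choquet game on a topological space $X$ is played by players I and II in stages $i=0,1,2,\ldots$. At stage $i$, player I plays an open set $U_i$ and a point $x_i\in U_i$, with $U_i\subseteq V_{i-1}$ if $i>0$; then player II plays an open set $V_i$ with $x_i\in V_i\subseteq U_i$. Player II wins if $\bigcap_i U_i\neq\varnothing$ (equivalently $\bigcap_i V_i\ne\varnothing$); otherwise player I wins. $X$ has the strong Choquet property if player II has a winning strategy, i.e. a function assigning to each finite position in which player II is to move a legal move of player II, such that player II wins every infinite play in which player II's moves are given by this function. *)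

(* Defs.v *)
From HB Require Import structures.
From mathcomp Require Import all_boot all_order.
From mathcomp Require Import all_classical.
From mathcomp Require Import topology.

Set Implicit Arguments.
Unset Strict Implicit.
Unset Printing Implicit Defensive.

Local Open Scope classical_set_scope.
Local Open Scope order_scope.

Definition homeomorphic (X Y : topologicalType) : Prop :=
  exists (f : X -> Y) (g : Y -> X),
    [/\ cancel f g, cancel g f, continuous f & continuous g].

(* Filters on a poset are sets of elements of [P], unlike the library's
   [Filter], which concerns families of subsets of a type. *)
Definition poset_filter d (P : porderType d) (F : set P) : Prop :=
  [/\ F !=set0,
      forall p q, F p -> F q -> exists r, [/\ F r, r <= p & r <= q]
    & forall p q, F p -> p <= q -> F q].

Definition maximal_filter d (P : porderType d) (F : set P) : Prop :=
  poset_filter F /\ forall G, poset_filter G -> ~ (F `<` G).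

Record MF d (P : porderType d) := mkMF {
  MF_set : set P;
  MF_maximal : maximal_filter MF_set }.

Definition MF_nbhd d (P : porderType d) (p : P) : set (MF P) :=
  [set F : MF P | MF_set F p].

(* The library's [isBaseTopological] asks for a pointed index type, but [P] may
   be empty; hence the direct definition of open sets as unions of basic ones,
   checked against the library's [basis] in [MF_basis] below. *)
Definition MF_open d (P : porderType d) : set_system (MF P) :=
  [set \bigcup_(p in D) MF_nbhd p | D in [set: set P]].

Section MF_topology.
Context d (P : porderType d).

Lemma MF_openP (U : set (MF P)) :
  MF_open U <->
  forall F, U F -> exists p, MF_nbhd p F /\ MF_nbhd p `<=` U.
Proof.
split=> [[D _ <-] F [p Dp pF]|H].
  by exists p; split=> // G pG; exists p.
exists [set p | MF_nbhd p `<=` U] => //; apply/seteqP; split=> [F [p pU]|F].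
  exact: pU.
by move=> /H[p [pF pU]]; exists p.
Qed.

Let MF_openT : MF_open [set: MF P].
Proof.
by apply/MF_openP => F _; have [[[p Fp] _ _] _] := MF_maximal F; exists p.
Qed.

Let MF_openI : setI_closed (@MF_open d P).
Proof.
move=> U V /MF_openP oU /MF_openP oV; apply/MF_openP => F [UF VF].
have [p [pF pU]] := oU _ UF; have [q [qF qV]] := oV _ VF.
have [[_ /(_ _ _ pF qF)[r [rF rp rq]] _] _] := MF_maximal F.
exists r; split=> // G rG; have [[_ _ upG] _] := MF_maximal G.
by split; [apply: pU; apply: upG rp|apply: qV; apply: upG rq].
Qed.

Let MF_open_bigU (I : Type) (f : I -> set (MF P)) :
  (forall i, MF_open (f i)) -> MF_open (\bigcup_i f i).
Proof.
move=> of_; apply/MF_openP => F [i _ fiF].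
have /MF_openP/(_ _ fiF)[p [pF pf]] := of_ i.
by exists p; split=> // G /pf; exists i.
Qed.

HB.instance Definition _ := gen_eqMixin (MF P).
HB.instance Definition _ := gen_choiceMixin (MF P).
HB.instance Definition _ :=
  isOpenTopological.Build (MF P) MF_openT MF_openI MF_open_bigU.

Lemma MF_basis : basis (range (@MF_nbhd d P)).
Proof.
split=> [_ [p _ <-]|F].
  by exists [set p] => //; rewrite bigcup_set1.
move=> A; rewrite nbhsE => -[U [oU UF] UA].
have /MF_openP/(_ _ UF)[p [pF pU]] : MF_open U by exact: oU.
by exists (MF_nbhd p); [split=> //; exists p|apply: subset_trans UA].
Qed.

End MF_topology.

Section strong_Choquet.
Context (X : topologicalType).

(* One stage of the game: the move (U_i, x_i) of player I, paired with the
   reply V_i of player II. *)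
Definition moveI := (set X * X)%type.
Definition stage := (moveI * set X)%type.

(* V_{i-1} after the stages i = 0, ..., size h - 1; the whole space at the
   start, where the first open set of player I is unconstrained. *)
Definition last_reply (h : seq stage) : set X := last setT [seq s.2 | s <- h].

Definition legalI (h : seq stage) (m : moveI) : Prop :=
  [/\ open m.1, m.1 m.2 & m.1 `<=` last_reply h].

Definition legalII (m : moveI) (V : set X) : Prop :=
  [/\ open V, V m.2 & V `<=` m.1].

(* Finite sequences of completed stages, in chronological order. *)
Inductive legal_history : seq stage -> Prop :=
| legal_history_nil : legal_history [::]
| legal_history_rcons h m V : legal_history h -> legalI h m -> legalII m V ->
    legal_history (rcons h (m, V)).

(* A position where player II is to move is a history together with the
   current move of player I. Values at illegal positions are irrelevant. *)
Definition strategyII := seq stage -> moveI -> set X.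

Definition legal_strategyII (sigma : strategyII) : Prop :=
  forall h m, legal_history h -> legalI h m -> legalII m (sigma h m).

Definition legal_play (play : nat -> stage) : Prop :=
  forall n, legal_history (mkseq play n).

Definition follows (sigma : strategyII) (play : nat -> stage) : Prop :=
  forall n, (play n).2 = sigma (mkseq play n) (play n).1.

Definition II_wins (play : nat -> stage) : Prop :=
  \bigcap_n (play n).1.1 !=set0.

Definition strong_Choquet : Prop :=
  exists sigma : strategyII, legal_strategyII sigma /\
    forall play, legal_play play -> follows sigma play -> II_wins play.

End strong_Choquet.

(* Main.v *)
Require Import Defs.
From HB Require Import structures.
From mathcomp Require Import all_boot all_order.
From mathcomp Require Import all_classical.
From mathcomp Require Import topology.

(** For the direct implication, player II answers with basic sets [N_p], each
    [p] below the previous one: these [p] generate a filter, and a maximal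
    filter containing it lies in every set played.

    Conversely, fix a countable base [B] and a winning strategy [sigma] of
    player II.  A condition is a nonempty basic set together with a finite set
    of positions in which player I may still play it.  A condition is below
    another if its basic set is smaller and if each position [h] of the larger
    condition has an extension in the smaller one, obtained when player I plays
    the larger basic set and player II follows [sigma].  A strictly decreasing
    sequence of conditions thus carries a run of the game won by player II, so
    its basic sets have a common point; by the T1 axiom this identifies the
    maximal filters with the points of the space.  Only countably many
    positions are needed: the point played by player I only matters through a
    basic set contained in the answer of player II. *)

Set Implicit Arguments.
Unset Strict Implicit.
Unset Printing Implicit Defensive.

Import Order.TTheory.

Local Open Scope order_scope.
Local Open Scope classical_set_scope.

(** * Filters and maximal filters on a poset *)

Section poset_filters.
Context d (P : porderType d).
Implicit Types F G : set P.

Lemma poset_filter_decreasing (p : nat -> P) :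
  (forall n, p n.+1 <= p n) -> poset_filter [set q | exists n, p n <= q].
Proof.
move=> pS; have p_anti m n : (m <= n)%N -> p n <= p m.
  move=> /subnK <-; elim: (n - m)%N => [|k IHk] //.
  by apply: le_trans IHk; rewrite addSn.
split=> [|q r [m mq] [n nr]|q r [n nq] qr].
- by exists (p 0%N), 0%N.
- exists (p (maxn m n)); split; first by exists (maxn m n).
    by apply: le_trans mq; apply: p_anti; rewrite leq_maxl.
  by apply: le_trans nr; apply: p_anti; rewrite leq_maxr.
- by exists n; apply: le_trans qr.
Qed.

Lemma poset_filter_up (p : P) : poset_filter [set q | p <= q].
Proof.
split=> [|q r pq pr|q r pq qr]; first by exists p => /=.
- by exists p; split=> //=.
- exact: le_trans qr.
Qed.

Lemma maximal_filter_extension F :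
  poset_filter F -> exists2 G, maximal_filter G & F `<=` G.
Proof.
(* Zorn's lemma is applied to the sets to be added to [F], not to the filters containing [F]: the
   union of the empty chain then causes no trouble. *)
move=> fF; pose S := [set H | poset_filter (F `|` H)].
have [C CS Ctot|A [SA Amax]] := @Zorn_bigcup P S.
  have [[p0 Fp0] dirF upF] := fF.
  split.
  - by exists p0; left.
  - have dirH H : C H -> forall p q, (F `|` H) p -> (F `|` H) q ->
        exists r, [/\ (F `|` \bigcup_(X in C) X) r, r <= p & r <= q].
      move=> CH p q Hp Hq; have [_ /(_ _ _ Hp Hq)[r [Hr rp rq]] _] := CS _ CH.
      by exists r; split=> //; case: Hr => ?; [left|right; exists H].
    move=> p q [Fp|[H CH Hp]] [Fq|[K CK Kq]].
    + by have [r [Fr rp rq]] := dirF _ _ Fp Fq; exists r; split=> //; left.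
    + by apply: (dirH K) => //; [left|right].
    + by apply: (dirH H) => //; [right|left].
    + have [HK|KH] := Ctot _ _ CH CK.
        by apply: (dirH K) => //; right=> //; exact: HK.
      by apply: (dirH H) => //; right=> //; exact: KH.
  - move=> p q [Fp|[H CH Hp]] pq; first by left; apply: upF pq.
    have [_ _ /(_ p q)] := CS _ CH; case=> //; first by right.
      by left.
    by right; exists H.
exists (F `|` A); last exact: subsetUl.
split=> // G fG [FAG nGFA]; apply: (Amax G).
  split; first by apply: subset_trans FAG; exact: subsetUr.
  by move=> GA; apply: nGFA => p /GA; right.
rewrite /S /= setUidr //; apply: subset_trans FAG; exact: subsetUl.
Qed.

(** Otherwise directedness makes [p] least in [F], and the principal filter of any [r < p] strictly
    contains [F]. *)
Lemma maximal_filter_strict F (p : P) : (forall q : P, exists r, r < q) ->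
  maximal_filter F -> F p -> exists2 q, F q & q < p.
Proof.
move=> nomin [fF maxF] Fp; apply: contrapT => noq.
have p_le q : F q -> p <= q.
  move=> Fq; have [_ /(_ _ _ Fp Fq)[r [Fr rp rq]] _] := fF.
  move: rp; rewrite le_eqVlt => /orP[/eqP <-//|rp].
  by case: noq; exists r.
have [r rp] := nomin p; apply: (maxF _ (poset_filter_up r)); split=> [q /p_le|].
  by apply: le_trans; exact: ltW.
by move=> /(_ r (lexx r))/p_le/le_gtF; rewrite rp.
Qed.

End poset_filters.

(** The poset is numbered by [e]; step [n] descends strictly inside [F], and below the element of
    [F] numbered [n] if there is one. *)
Lemma maximal_filter_coinitial d (P : porderType d) (F : set P) :
  countable [set: P] -> (forall q : P, exists r, r < q) -> maximal_filter F ->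
  exists p : nat -> P, [/\ forall n, F (p n), forall n, p n.+1 < p n
                        & forall q, F q -> exists n, p n <= q].
Proof.
move=> /countable_injP[e einj] nomin maxF.
have [[[p0 Fp0] dirF _] _] := maxF.
have /choice[next nextP] : forall np : nat * P, exists r, F np.2 ->
    [/\ F r, r < np.2 & forall q, F q -> e q = np.1 -> r <= q].
  move=> [n p]; have [/= Fp|nFp] := pselect (F p); last by exists p.
  have [[q [Fq eq]]|noq] := pselect (exists q, F q /\ e q = n).
    have [r0 [Fr0 r0p r0q]] := dirF _ _ Fp Fq.
    have [r Fr rr0] := maximal_filter_strict nomin maxF Fr0.
    exists r => _; split=> // [|q' _ eq']; first exact: lt_le_trans r0p.
    have -> : q' = q by apply: einj; rewrite ?inE// eq' eq.
    exact: le_trans (ltW rr0) r0q.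
  have [r Fr rp] := maximal_filter_strict nomin maxF Fp.
  by exists r => _; split=> // q Fq eq; case: noq; exists q.
pose p := fix p n := if n is m.+1 then next (m, p m) else p0.
have Fp n : F (p n) by elim: n => //= n /(nextP (n, _))[].
exists p; split=> // [n|q Fq]; first by have [] := nextP (n, p n) (Fp n).
by exists (e q).+1; have [_ _ /(_ q Fq erefl)] := nextP (e q, p (e q)) (Fp _).
Qed.

(** [N p] plays the role of [N_p] on a space identified with [MF P]. *)
Definition MF_representation (X : topologicalType) d (P : porderType d)
    (N : P -> set X) : Prop :=
  [/\ forall p, open (N p),
      forall x U, open U -> U x -> exists2 p, N p x & N p `<=` U,
      forall x, maximal_filter [set p | N p x],
      forall F, maximal_filter F -> exists x, F = [set p | N p x]
    & forall x y, (forall p, N p x -> N p y) -> x = y].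

(** * Representations and the properties of the space that they give *)

Section representation.
Context (X : topologicalType) d (P : porderType d).

Lemma MF_eq (F G : MF P) : MF_set F `<=` MF_set G -> F = G.
Proof.
case: F G => [F maxF] [G maxG] /= FG.
have FGE : F = G.
  apply: contrapT => neqFG; apply: maxF.2 maxG.1 _; split=> // GF.
  by apply: neqFG; apply/seteqP.
by subst G; congr mkMF; exact: Prop_irrelevance.
Qed.

(** A homeomorphism pulls the basic sets back to [N]. Conversely, sending a point to its filter is
    continuous because each [N p] is open, and its inverse is continuous because they form a
    base. *)
Lemma homeomorphic_MFP :
  homeomorphic X (MF P) <-> exists N : P -> set X, MF_representation N.
Proof.
split=> [[f [g [fK gK cf cg]]]|[N [oN bN maxN surjN injN]]].
  have fE x : [set p | MF_set (f x) p] = MF_set (f x) by [].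
  exists (fun p => f @^-1` MF_nbhd p); split.
  - move=> p; apply: (iffLR (continuousP _)) => //.
    by exists [set p] => //; rewrite bigcup_set1.
  - move=> x U oU Ux; have : open (g @^-1` U) by apply: (iffLR (continuousP _)).
    move=> /MF_openP/(_ (f x))[|p [pfx pU]]; first by rewrite /= fK.
    by exists p => // y /pU; rewrite /= fK.
  - by move=> x; rewrite fE; exact: MF_maximal.
  - move=> F maxF; exists (g (mkMF maxF)).
    by have /(congr1 (@MF_set _ _)) := gK (mkMF maxF).
  - by move=> x y xy; rewrite -(fK x) -(fK y); congr g; exact: MF_eq.
pose f x := mkMF (maxN x).
have /choice[g gE] : forall F : MF P, exists x, MF_set F = [set p | N p x].
  by move=> F; apply: surjN; exact: MF_maximal.
exists f, g; split.
- move=> x; apply/esym/injN => p px.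
  by have : MF_set (f x) p := px; rewrite gE.
- by move=> F; apply: MF_eq => p pgF; rewrite gE.
- apply/continuousP => U [D _ <-]; rewrite preimage_bigcup.
  by apply: bigcup_open => p _; exact: oN.
- apply/continuousP => U oU; apply/MF_openP => F UgF.
  have [p pgF pU] := bN _ _ oU UgF; exists p; split; rewrite /MF_nbhd /=.
    by rewrite gE.
  by move=> G; rewrite /= gE => /pU.
Qed.

Context (N : P -> set X).
Hypothesis repN : MF_representation N.

Lemma MF_representation_second_countable :
  countable [set: P] -> @second_countable X.
Proof.
have [oN bN _ _ _] := repN => cP.
exists (range N); first exact: (sub_countable (card_image_le _ _)).
split=> [_ [p _ <-]|x A]; first exact: oN.
rewrite nbhsE => -[U [oU Ux] UA]; have [p px pU] := bN _ _ oU Ux.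
by exists (N p); [split=> //; exists p|exact: subset_trans UA].
Qed.

Lemma MF_representation_accessible : accessible_space X.
Proof.
have [oN _ _ _ injN] := repN => x y /eqP neq.
apply: contrapT => noA; apply: neq; apply: injN => p px.
apply: contrapT => npy; apply: noA; exists (N p).
by split; rewrite ?inE.
Qed.

End representation.

Lemma legal_history_rcons_inv (X : topologicalType) (h : seq (stage X)) s :
  legal_history (rcons h s) ->
  [/\ legal_history h, legalI h s.1 & legalII s.1 s.2].
Proof.
move=> hs; inversion hs as [e|h' m V lh lI lII e].
  by move: (congr1 size e); rewrite size_rcons.
by move: e => /rcons_inj[<- <-].
Qed.

(** * A winning strategy of player II from a representation *)

Section representation_strategy.
Context (X : topologicalType) d (P : porderType d) (N : P -> set X).
Hypothesis repN : MF_representation N.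

(** Here [q] is the element answered at the previous stage, [None] at the start. Descent below it is
    asked only if the new point lies in its set, so that an answer exists at every position. *)
Let good (q : option P) (m : moveI X) (o : option P) : Prop :=
  if o is Some p then
    [/\ N p m.2, N p `<=` m.1 & forall q', q = Some q' -> N q' m.2 -> p <= q']
  else False.

Let next q m : option P := xget None [set o | good q m o].

Let nextP q (m : moveI X) : open m.1 -> m.1 m.2 -> good q m (next q m).
Proof.
have [_ bN maxN _ _] := repN => om xm; have [p px pm] := bN _ _ om xm.
have [[_ dirF upF] _] := maxN m.2.
suff [o mo] : exists o, good q m o
  by exact: (@xgetI _ None [set o | good q m o] o mo).
have [[q' [qE q'x]]|noq] := pselect (exists q', q = Some q' /\ N q' m.2).
  have [r [rx rp rq']] := dirF _ _ px q'x; exists (Some r); split=> //.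
    move=> y ry; apply: pm; have [[_ _ upFy] _] := maxN y.
    exact: upFy rp.
  by move=> q''; rewrite qE => -[<-].
by exists (Some p); split=> // q' qE q'x; case: noq; exists q'.
Qed.

(** A reply [N p] need not determine [p], so the element is recomputed from the moves of player
    I. *)
Let state (h : seq (stage X)) := foldl (fun q s => next q s.1) None h.

Lemma MF_representation_strong_Choquet : strong_Choquet X.
Proof.
have [oN _ _ surjN _] := repN.
exists (fun h m => oapp N setT (next (state h) m)); split=> [h m _ [om xm _]|].
  by have := nextP (state h) om xm; case: (next _ m) => //= p [].
move=> play lplay fplay.
have lI n : legalI (mkseq play n) (play n).1.
  by have := lplay n.+1; rewrite mkseqS => /legal_history_rcons_inv[].
have stateS n :
    state (mkseq play n.+1) = next (state (mkseq play n)) (play n).1.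
  by rewrite mkseqS /state foldl_rcons.
have /choice[p pP] : forall n, exists p, state (mkseq play n.+1) = Some p /\
    good (state (mkseq play n)) (play n).1 (Some p).
  move=> n; have [om xm _] := lI n; have := nextP (state (mkseq play n)) om xm.
  by rewrite -stateS; case: (state (mkseq play n.+1)) => // p; exists p.
have replyE n : (play n).2 = N (p n) by rewrite fplay -stateS (pP n).1.
(* Legality puts the next point in the last reply [N (p n)], so the descent clause of [good]
   applies. *)
have p_anti n : p n.+1 <= p n.
  have [_ [_ _ le_p]] := pP n.+1; apply: le_p; first exact: (pP n).1.
  have [_ xU /(_ _ xU)] := lI n.+1.
  by rewrite /last_reply mkseqS map_rcons last_rcons replyE.
have [F maxF pF] := maximal_filter_extension (poset_filter_decreasing p_anti).
have [x Fx] := surjN _ maxF; exists x => n _.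
have [_ [_ pU _]] := pP n; apply: pU.
by have : F (p n) by [apply: pF; exists n]; rewrite Fx.
Qed.

End representation_strategy.

(** * The poset of conditions built from a strategy of player II *)

Section conditions.
Context (X : topologicalType) (sigma : strategyII X) (B : nat -> set X).

Definition code := seq (nat * nat).

(** The pair [(n, k)] stands for the move of player I that plays [B n] with some
    point for which the answer of player II contains [B k]; codes of
    impossible moves are skipped. *)
Definition coded_points (h : seq (stage X)) (n k : nat) : set X :=
  [set x | legalI h (B n, x) /\ B k `<=` sigma h (B n, x)].

Definition coded_step (h : seq (stage X)) (a : nat * nat) : seq (stage X) :=
  if pselect (coded_points h a.1 a.2 !=set0) is left ex then
    let m := (B a.1, projT1 (cid ex)) in rcons h (m, sigma h m)
  else h.

Definition history_of (c : code) : seq (stage X) := foldl coded_step [::] c.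

(** The empty code provides a position from which runs can start. *)
Definition valid_condition (p : nat * seq code) : Prop :=
  [/\ B p.1 !=set0, [::] \in p.2
    & forall c, c \in p.2 -> B p.1 `<=` last_reply (history_of c)].

(** As a boolean subtype of a countable type, this type inherits countability. *)
Definition condition := {p : nat * seq code | `[< valid_condition p >]}.

Implicit Types p q r : condition.

Definition index_of p : nat := (val p).1.
Definition codes_of p : seq code := (val p).2.

Definition condition_lt p q : bool :=
  `[< [/\ B (index_of p) `<=` B (index_of q),
          {subset codes_of q <= codes_of p}
        & forall c, c \in codes_of q -> exists2 k,
            coded_points (history_of c) (index_of q) k !=set0
          & rcons c (index_of q, k) \in codes_of p] >].

Lemma conditionP p : valid_condition (val p).
Proof. exact/asboolP/(valP p). Qed.

(* In a condition below itself every code would have a proper extension. *)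
Lemma condition_lt_irr : irreflexive condition_lt.
Proof.
move=> p; apply/asboolP => -[_ _ ext]; have [_ nil_p _] := conditionP p.
have long n : exists2 c, c \in codes_of p & size c = n.
  elim: n => [|n [c cp <-]]; first by exists [::].
  have [k _ kp] := ext _ cp.
  by exists (rcons c (index_of p, k)); rewrite ?size_rcons.
have [c cp szc] := long (\max_(c <- codes_of p) size c).+1.
by have := leq_bigmax_seq c (P := predT) (F := size) cp isT; rewrite szc ltnn.
Qed.

(** The extensions required by the largest condition lie in the middle one, and survive in the
    smallest since codes are never dropped. *)
Lemma condition_lt_trans : transitive condition_lt.
Proof.
move=> q p r /asboolP[pq sqp _] /asboolP[qr srq ext]; apply/asboolP.
split=> [|c /srq /sqp//|c /ext[k kr /sqp]]; first exact: subset_trans qr.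
by exists k.
Qed.

HB.instance Definition _ := Countable.on condition.
HB.instance Definition _ := Order.Lt_isPOrder.Build Order.default_display
  condition condition_lt_irr condition_lt_trans.

Lemma condition_ltP p q :
  reflect [/\ B (index_of p) `<=` B (index_of q),
              {subset codes_of q <= codes_of p}
            & forall c, c \in codes_of q -> exists2 k,
                coded_points (history_of c) (index_of q) k !=set0
              & rcons c (index_of q, k) \in codes_of p]
          (p < q).
Proof. exact: asboolP. Qed.

Lemma condition_le_sub p q : p <= q -> B (index_of p) `<=` B (index_of q).
Proof. by rewrite le_eqVlt => /orP[/eqP -> //|/condition_ltP[]]. Qed.

Hypothesis sigma_legal : legal_strategyII sigma.
Hypothesis sigma_wins :
  forall play, legal_play play -> follows sigma play -> II_wins play.
Hypothesis B_open : forall n, open (B n).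
Hypothesis B_basis :
  forall x U, open U -> U x -> exists2 n, B n x & B n `<=` U.

Lemma history_of_rcons c n k :
  coded_points (history_of c) n k !=set0 -> exists2 x,
    coded_points (history_of c) n k x
  & history_of (rcons c (n, k)) =
      rcons (history_of c) ((B n, x), sigma (history_of c) (B n, x)).
Proof.
move=> ex; rewrite /history_of foldl_rcons -/(history_of c) /coded_step.
by case: pselect => //= ex'; case: cid => x xP; exists x.
Qed.

Lemma legal_history_of c : legal_history (history_of c).
Proof.
elim/last_ind: c => [|c [n k] IHc]; first exact: legal_history_nil.
have [/history_of_rcons[x [lI _] ->]|nex] :=
  pselect (coded_points (history_of c) n k !=set0).
  by apply: legal_history_rcons => //; exact: sigma_legal.
by rewrite /history_of foldl_rcons /coded_step -/(history_of c); case: pselect.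
Qed.

Lemma open_last_reply (h : seq (stage X)) :
  legal_history h -> open (last_reply h).
Proof.
case=> [|h' m V _ _ [oV _ _]]; first exact: openT.
by rewrite /last_reply map_rcons last_rcons.
Qed.

(** [B k] is chosen inside the answer to [x] itself. The history may record another point [y], but
    the answer to [y] also contains [B k], hence [x]. *)
Lemma coded_answer c n x : B n `<=` last_reply (history_of c) -> B n x ->
  exists k, coded_points (history_of c) n k !=set0 /\
            last_reply (history_of (rcons c (n, k))) x.
Proof.
move=> Bc Bx; have lI y : B n y -> legalI (history_of c) (B n, y).
  by split=> //; exact: B_open.
have [oV Vx _] := sigma_legal (legal_history_of c) (lI _ Bx).
have [k kx kV] := B_basis oV Vx; exists k.
have ex : coded_points (history_of c) n k !=set0.
  by exists x; split=> //; exact: lI.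
split=> //; have [y [_ ky] ->] := history_of_rcons ex.
by rewrite /last_reply map_rcons last_rcons; exact: ky.
Qed.

(** Finiteness of [s] makes the intersection of the last replies an open neighbourhood of [x]. *)
Lemma condition_exists x (U : set X) (s : seq code) : open U -> U x ->
  [::] \in s -> (forall c, c \in s -> last_reply (history_of c) x) ->
  exists p, [/\ codes_of p = s, B (index_of p) x & B (index_of p) `<=` U].
Proof.
move=> oU Ux nil_s sx.
have [W [oW Wx Ws]] : exists W, [/\ open W, W x &
    forall c, c \in s -> W `<=` last_reply (history_of c)].
  elim: s sx {nil_s} => [|c s IHs] sx.
    by exists setT; split=> //; exact: openT.
  have [c' c's|W [oW Wx Ws]] := IHs; first by apply: sx; rewrite inE c's orbT.
  exists (last_reply (history_of c) `&` W); split.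
  - by apply: openI => //; exact: open_last_reply (legal_history_of c).
  - by split=> //; apply: sx; rewrite mem_head.
  - move=> c'; rewrite inE => /orP[/eqP ->|/Ws]; first exact: subIsetl.
    by apply: subset_trans; exact: subIsetr.
have [n nx nUW] := B_basis (openI oU oW) (conj Ux Wx).
have np : valid_condition (n, s).
  by split=> [||c /Ws] /=; [exists x| |apply: subset_trans => y /nUW[]].
by exists (exist _ (n, s) (asboolT np)); split=> // y /nUW[].
Qed.

Lemma codes_extension p x : B (index_of p) x -> exists s : seq code,
  (forall c, c \in codes_of p -> exists2 k,
     coded_points (history_of c) (index_of p) k !=set0
   & rcons c (index_of p, k) \in s) /\
  (forall c, c \in s -> last_reply (history_of c) x).
Proof.
have [_ _ Bp] := conditionP p => px.
have /choice[k kP] : forall c, exists k, c \in codes_of p ->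
    coded_points (history_of c) (index_of p) k !=set0 /\
    last_reply (history_of (rcons c (index_of p, k))) x.
  move=> c; have [cp|] := boolP (c \in codes_of p); last by exists 0%N.
  by have [k kP] := coded_answer (Bp _ cp) px; exists k.
exists [seq rcons c (index_of p, k c) | c <- codes_of p].
split=> [c cp|_ /mapP[c cp ->]]; last by have [] := kP c cp.
by exists (k c); [have [] := kP c cp|exact: map_f].
Qed.

Lemma condition_refine p q x : B (index_of p) x -> B (index_of q) x ->
  exists r, [/\ r < p, r < q & B (index_of r) x].
Proof.
move=> px qx; have [s [ps sx]] := codes_extension px.
have [t [qt tx]] := codes_extension qx.
have [[_ nil_p Bp] [_ _ Bq]] := (conditionP p, conditionP q).
(* The old codes of [p] and [q] are kept and both families of extensions added, so that [r] lies
   below both. *)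
have [||||r [rE rx rU]] := @condition_exists x
  (B (index_of p) `&` B (index_of q)) (codes_of p ++ codes_of q ++ s ++ t).
- exact: openI.
- by [].
- by rewrite mem_cat nil_p.
- move=> c; rewrite !mem_cat => /or4P[/Bp|/Bq|/sx|/tx]//; exact.
exists r; split=> //; apply/condition_ltP; rewrite rE; split.
- by move=> y /rU[].
- by move=> c cp; rewrite mem_cat cp.
- by move=> c /ps[k kp ks]; exists k => //; rewrite !mem_cat ks !orbT.
- by move=> y /rU[].
- by move=> c cq; rewrite !mem_cat cq orbT.
- by move=> c /qt[k kq kt]; exists k => //; rewrite !mem_cat kt !orbT.
Qed.

Lemma decreasing_conditions (p : nat -> condition) :
  (forall n, p n.+1 < p n) -> exists x, forall n, B (index_of (p n)) x.
Proof.
move=> pS; have /choice[k kP] : forall nc : nat * code, exists k,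
    nc.2 \in codes_of (p nc.1) ->
    coded_points (history_of nc.2) (index_of (p nc.1)) k !=set0 /\
    rcons nc.2 (index_of (p nc.1), k) \in codes_of (p nc.1.+1).
  move=> [n c].
  have [/= cp|] := boolP (c \in codes_of (p n)); last by exists 0%N.
  by have /condition_ltP[_ _ /(_ _ cp)[k kp kS]] := pS n; exists k.
(* A single thread of codes, [c n] in [p n]; no move in it is skipped, so its histories are the
   initial segments of one play. *)
pose c := fix c n : code :=
  if n is m.+1 then rcons (c m) (index_of (p m), k (m, c m)) else [::].
have c_in n : c n \in codes_of (p n).
  by elim: n => [|n /(kP (n, _))[]//]; have [] := conditionP (p 0%N).
have /choice[x xP] : forall n, exists x, history_of (c n.+1) =
    rcons (history_of (c n)) ((B (index_of (p n)), x),
      sigma (history_of (c n)) (B (index_of (p n)), x)).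
  move=> n; have [/history_of_rcons[x _ cE] _] := kP (n, c n) (c_in n).
  by exists x.
pose m n := (B (index_of (p n)), x n).
pose play n := (m n, sigma (history_of (c n)) (m n)).
have playE n : mkseq play n = history_of (c n).
  by elim: n => [//|n IHn]; rewrite mkseqS IHn xP.
have lplay : legal_play play.
  by move=> n; rewrite playE; exact: legal_history_of.
have fplay : follows sigma play by move=> n; rewrite playE.
by have [y yB] := sigma_wins lplay fplay; exists y => n; exact: yB.
Qed.

(** * Identification of the maximal filters of conditions with the points *)

Hypothesis X_T1 : accessible_space X.

Lemma T1_separation x y : x <> y -> exists2 n, B n x & ~ B n y.
Proof.
move=> /eqP/X_T1[A [oA]]; rewrite !inE => Ax nAy.
by have [n nx nA] := B_basis oA Ax; exists n => // /nA.
Qed.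

Lemma open_condition x (U : set X) : open U -> U x ->
  exists2 p, B (index_of p) x & B (index_of p) `<=` U.
Proof.
move=> oU Ux; have [||p [_ px pU]] := condition_exists (s := [:: [::]]) oU Ux.
- by rewrite mem_head.
- by move=> c; rewrite inE => /eqP ->.
- by exists p.
Qed.

Lemma point_filter x : poset_filter [set p | B (index_of p) x].
Proof.
split=> [|p q px qx|p q px /condition_le_sub]; last exact.
- by have [p px _] := open_condition openT (I : setT x); exists p.
- have [r [rp rq rx]] := condition_refine px qx.
  by exists r; split=> //; exact: ltW.
Qed.

Lemma maximal_filter_point (F : set condition) : maximal_filter F ->
  exists x, F `<=` [set p | B (index_of p) x].
Proof.
move=> maxF.
(* Refining [p] against itself gives a strictly smaller condition. *)
have nomin p : exists r, r < p.
  have [[x px] _ _] := conditionP p.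
  by have [r [rp _ _]] := condition_refine px px; exists r.
have [p [_ p_lt pF]] :=
  maximal_filter_coinitial (countableP [set: condition]) nomin maxF.
have [x xp] := decreasing_conditions p_lt; exists x => q /pF[n pq].
exact: condition_le_sub pq _ (xp n).
Qed.

Lemma conditions_separate x y :
  (forall p, B (index_of p) x -> B (index_of p) y) -> x = y.
Proof.
move=> xy; apply: contrapT => /T1_separation[n nx]; apply.
by have [p px pn] := open_condition (B_open n) nx; exact/pn/xy.
Qed.

(** A larger filter extends to a maximal one, all of whose basic sets contain some [y]; then [y]
    lies in every basic set around [x], and [T1] gives [x = y]. *)
Lemma point_filter_maximal x : maximal_filter [set p | B (index_of p) x].
Proof.
split=> [|G fG [xG Gx]]; first exact: point_filter.
have [H maxH GH] := maximal_filter_extension fG.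
have [y Hy] := maximal_filter_point maxH.
have xyE : x = y by apply: conditions_separate => p /xG/GH/Hy.
by apply: Gx; rewrite xyE; exact: subset_trans Hy.
Qed.

Lemma condition_representation :
  MF_representation (fun p : condition => B (index_of p)).
Proof.
split=> [p|||F maxF|]; first exact: B_open.
- exact: open_condition.
- exact: point_filter_maximal.
- have [x Fx] := maximal_filter_point maxF; exists x.
  apply/seteqP; split=> //; apply: contrapT => xF.
  by case: maxF => _ /(_ _ (point_filter x)); apply.
- exact: conditions_separate.
Qed.

End conditions.

Lemma second_countable_sequence (X : topologicalType) : @second_countable X ->
  exists B : nat -> set X, (forall n, open (B n)) /\
    forall x U, open U -> U x -> exists2 n, B n x & B n `<=` U.
Proof.
move=> [C /countable_injP[e einj] [Copen Cbasis]].
have getE (U : set X) : C U -> xget set0 [set V | C V /\ e V = e U] = U.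
  move=> CU; have [CV eV] : [set V | C V /\ e V = e U]
      (xget set0 [set V | C V /\ e V = e U])
    by apply: (xgetPex _ (ex_intro _ U _)).
  by apply: einj; rewrite ?inE.
(* This inverts [e] on [C]; numbers outside its image get the empty set, which is open. *)
exists (fun n => xget set0 [set U | C U /\ e U = n]); split=> [n|x U oU Ux].
  by case: xgetP => [U _ [/Copen]|_]; [|exact: open0].
have [V [CV Vx] VU] := Cbasis x U (open_nbhs_nbhs (conj oU Ux)).
by exists (e V); rewrite getE.
Qed.

Theorem theorem5p3 (X : topologicalType) :
  (exists (d : Order.disp_t) (P : porderType d),
     countable [set: P] /\ homeomorphic X (MF P)) <->
  [/\ @second_countable X, accessible_space X & strong_Choquet X].
Proof.
split=> [[d [P [cP /homeomorphic_MFP[N repN]]]]|[sc T1 [sigma [legal wins]]]].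
  split.
  - exact: MF_representation_second_countable repN cP.
  - exact: MF_representation_accessible repN.
  - exact: MF_representation_strong_Choquet repN.
have [B [Bopen Bbasis]] := second_countable_sequence sc.
exists Order.default_display, (condition sigma B : porderType _).
split; first exact: countableP.
apply/homeomorphic_MFP; exists (fun p : condition sigma B => B (index_of p)).
exact: condition_representation.
Qed.
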